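(* Let $n \ge 2$ and let $x_1 < x_2 < \dots < x_n$ be real numbers (an ordered sample). For $i = 1,\dots,n$ set $$y_i = \frac{1}{n}\sum_{j=1}^n (x_i - x_j)\, I_{x_j \le x_i}.$$ Define the centre difference estimator at the sample points by $$\hat F_C(x_1) = \frac{y_2-y_1}{x_2-x_1}, \qquad \hat F_C(x_i) = \frac{y_{i+1}-y_{i-1}}{x_{i+1}-x_{i-1}}\quad (i=2,\dots,n-1), \qquad \hat F_C(x_n) = \frac{y_n-y_{n-1}}{x_n-x_{n-1}}.$$ Then $$\hat F_C(x_1) = \frac1n, \qquad \hat F_C(x_i) = \frac{i}{n} - \frac{1}{n}\,\frac{x_i-x_{i-1}}{x_{i+1}-x_{i-1}}\quad (i=2,\dots,n-1), \qquad \hat F_C(x_n) = \frac{n-1}{n}.$$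
   Context: $I_A$ is $1$ if the condition $A$ holds and $0$ otherwise. The number $y_i$ is the empirical left mean absolute deviation function, i.e. the sample version of $v \mapsto E[(v-X)I_{X\le v}]$, evaluated at $v = x_i$. *)

(* Defs.v *)
From mathcomp Require Import all_boot all_order all_algebra.
From mathcomp Require Import reals.

Set Implicit Arguments.
Unset Strict Implicit.
Unset Printing Implicit Defensive.

Import Order.TTheory GRing.Theory Num.Theory.
Local Open Scope ring_scope.

(* A sample x_1, ..., x_n is the restriction to the indices 1, ..., n of a
   function x : nat -> R; the values of x at other indices are never used. *)

Definition ordered_sample (R : realType) (n : nat) (x : nat -> R) : Prop :=
  forall i : nat, (1 <= i < n)%N -> x i < x i.+1.

(* Sample version of v |-> E[(v - X) I_{X <= v}]. *)
Definition empirical_left_mad (R : realType) (n : nat) (x : nat -> R) (v : R)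
  : R :=
  n%:R^-1 * \sum_(1 <= j < n.+1) (v - x j) * (x j <= v)%R%:R.

Definition left_mad_at (R : realType) (n : nat) (x : nat -> R) (i : nat) : R :=
  empirical_left_mad n x (x i).

(* The centre difference estimator at the sample point x_i, for 1 <= i <= n and
   n >= 2; one-sided differences are used at the two end points. *)
Definition centre_diff_estimator (R : realType) (n : nat) (x : nat -> R)
    (i : nat) : R :=
  let y := left_mad_at n x in
  if i == 1%N then (y 2%N - y 1%N) / (x 2%N - x 1%N)
  else if i == n then (y n - y n.-1) / (x n - x n.-1)
  else (y i.+1 - y i.-1) / (x i.+1 - x i.-1).

(* Main.v *)
(** For an ordered sample the indicator truncates the sum defining [y_i] at
    [j = i], and the last term vanishes.  Hence
    [y_(i+1) - y_i = (i/n) (x_(i+1) - x_i)]: the left mean absolute deviation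
    function is piecewise linear with the empirical distribution function as
    slope, and the estimator is read off one or two consecutive increments. *)
Require Import Defs.
From mathcomp Require Import all_boot all_order all_algebra.
From mathcomp Require Import reals.
From mathcomp Require Import zify ring.

Import Order.TTheory GRing.Theory Num.Theory.
Local Open Scope ring_scope.

Lemma ordered_sample_lt {R : realType} {n : nat} {x : nat -> R} :
  ordered_sample n x ->
  forall i j : nat, (1 <= i)%N -> (i < j <= n)%N -> x i < x j.
Proof.
move=> hx i j i1; elim: j => [|j IHj] //; rewrite ltnS => /andP[].
rewrite leq_eqVlt => /orP[/eqP <-|ij] jn; first by apply: hx; lia.
by apply: lt_trans (IHj _) (hx _ _); lia.
Qed.

Lemma left_mad_at_ordered {R : realType} {n : nat} {x : nat -> R} {i : nat} :
  ordered_sample n x -> (1 <= i <= n)%N ->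
  left_mad_at n x i = n%:R^-1 * \sum_(1 <= j < i.+1) (x i - x j).
Proof.
move=> hx /andP[i1 le_in]; congr (_ * _).
rewrite (@big_cat_nat _ _ _ i.+1) //=.
rewrite [X in _ + X]big_nat_cond [X in _ + X]big1 ?addr0 => [|j hj].
  (* Strict monotonicity settles only [j < i]; at [j = i] the factor [x i - x j] is already zero. *)
  apply: eq_big_nat => j /andP[j1]; rewrite ltnS leq_eqVlt => /orP[/eqP ->|ji].
    by rewrite subrr mul0r.
  by rewrite ltW ?mulr1 //; apply: (ordered_sample_lt hx); lia.
by rewrite leNgt (ordered_sample_lt hx) ?mulr0 //; lia.
Qed.

Lemma left_mad_at_increment {R : realType} {n : nat} {x : nat -> R} {i : nat} :
  ordered_sample n x -> (1 <= i < n)%N ->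
  left_mad_at n x i.+1 - left_mad_at n x i = i%:R / n%:R * (x i.+1 - x i).
Proof.
move=> hx hi; rewrite !left_mad_at_ordered //; try lia.
(* The top term of the longer sum is zero, so both sums run over [1 <= j <= i]; in their termwise
   difference [x j] cancels. *)
rewrite (big_nat_recr i.+1) //= subrr addr0 -mulrBr -sumrB.
under eq_bigr => j _ do rewrite opprB addrA subrK.
rewrite sumr_const_nat subn1 -mulr_natl; ring.
Qed.

Theorem theorem5 (R : realType) (n : nat) (x : nat -> R)
    (hn : (2 <= n)%N) (hx : ordered_sample n x) :
  centre_diff_estimator n x 1 = 1 / n%:R /\
  (forall i : nat, (2 <= i <= n.-1)%N ->
     centre_diff_estimator n x i =
       i%:R / n%:R - 1 / n%:R * ((x i - x i.-1) / (x i.+1 - x i.-1))) /\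
  centre_diff_estimator n x n = (n%:R - 1) / n%:R.
Proof.
have lt_sub i j : (1 <= i)%N -> (i < j <= n)%N -> x j - x i != 0.
  by move=> i1 ij; rewrite subr_eq0 gt_eqF // (ordered_sample_lt hx).
have n0 : n%:R != 0 :> R by rewrite pnatr_eq0; lia.
rewrite /centre_diff_estimator; split; [|split=> [i hi|]].
- by rewrite eqxx left_mad_at_increment // mulfK // lt_sub.
- rewrite !ifF; [|lia|lia].
  case: i hi => [|k] hi /=; first by lia.
  have d0 : x k.+2 - x k != 0 by apply: lt_sub; lia.
  (* Inserting the middle value gives two increments, of slopes [k.+1 / n] and [k / n]; the deficit
     [1 / n] on the left gap is the correction term. *)
  rewrite -(subrKA (left_mad_at n x k.+1)).
  rewrite !left_mad_at_increment //; try lia.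
  by rewrite -[k.+1]addn1 natrD; field; rewrite n0 addn1 d0.
- rewrite ifF; last by lia.
  (* With [n = m.+1] the last slope is [m / n]. *)
  case: n hn hx lt_sub {n0} => [|m] // hn hx lt_sub /=.
  rewrite eqxx left_mad_at_increment ?mulfK //; try lia.
    by rewrite -[m.+1]addn1 natrD addrK.
  by apply: lt_sub; lia.
Qed.
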